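(* For $m\ge 3$, let $W_m$ be the wheel graph with $m$ rim vertices and let $\Delta$ be its maximum degree. Then $$\chi''_{\Sigma}(W_m)=\begin{cases}\Delta+1 & \text{if } m\ge 4,\\ \Delta+2 & \text{if } m=3.\end{cases}$$
   Context: All graphs are finite and simple. A proper total $k$-coloring of a graph $G$ assigns to every vertex and every edge a color from $\{1,\dots,k\}$ such that adjacent vertices receive different colors, edges sharing an endpoint receive different colors, and no edge receives the same color as either of its endpoints. For such a coloring $c$ and a vertex $v$, let $f(v)=c(v)+\sum_{e\ni v} c(e)$ (sum over edges incident to $v$). The coloring distinguishes adjacent vertices by sums if $f(u)\neq f(v)$ for every edge $uv$. $\chi''_{\Sigma}(G)$ (the adjacent vertex distinguishing index by sums) denotes the smallest $k$ such that $G$ has a proper total $k$-coloring distinguishing adjacent vertices by sums. The wheel $W_m$ consists of a cycle on $m$ vertices together with a central vertex adjacent to all of them; in particular $W_3=K_4$. *)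

(* Defs.v *)
From mathcomp Require Import all_boot.

Set Implicit Arguments.
Unset Strict Implicit.
Unset Printing Implicit Defensive.

Record sgraph := SGraph {
  vertex :> finType;
  adj : rel vertex;
  adj_sym : symmetric adj;
  adj_irr : irreflexive adj }.

Definition edges (G : sgraph) : {set {set G}} :=
  [set e | [exists u : G, exists v : G, adj u v && (e == [set u; v])]].

Definition degree (G : sgraph) (v : G) : nat := #|[set u : G | adj v u]|.

Definition max_degree (G : sgraph) : nat := \max_(v : G) degree v.

(* A total coloring is given by its vertex part [cv] and its edge part [ce];  *)
(* the values of [ce] on sets that are not edges are irrelevant.              *)
Definition proper_total_coloring (G : sgraph) (k : nat)
    (cv : G -> nat) (ce : {set G} -> nat) : Prop :=
  [/\ (forall v : G, 1 <= cv v <= k) /\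
      (forall e : {set G}, e \in edges G -> 1 <= ce e <= k),
      forall u v : G, adj u v -> cv u <> cv v,
      forall e1 e2 : {set G}, e1 \in edges G -> e2 \in edges G ->
        e1 <> e2 -> (exists v : G, v \in e1 /\ v \in e2) -> ce e1 <> ce e2
    & forall (e : {set G}) (v : G), e \in edges G -> v \in e -> ce e <> cv v].

Definition total_sum (G : sgraph) (cv : G -> nat) (ce : {set G} -> nat)
    (v : G) : nat :=
  cv v + \sum_(e in edges G | v \in e) ce e.

Definition sum_distinguishing (G : sgraph)
    (cv : G -> nat) (ce : {set G} -> nat) : Prop :=
  forall u v : G, adj u v -> total_sum cv ce u <> total_sum cv ce v.

Definition sum_colorable (G : sgraph) (k : nat) : Prop :=
  exists (cv : G -> nat) (ce : {set G} -> nat),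
    proper_total_coloring k cv ce /\ sum_distinguishing cv ce.

(* [is_avd_sum_index G k] states that chi''_Sigma(G) = k.                     *)
Definition is_avd_sum_index (G : sgraph) (k : nat) : Prop :=
  sum_colorable G k /\ forall k' : nat, sum_colorable G k' -> k <= k'.

(* [None] is the center and [Some i] the rim vertices, with [ordS] the cyclic *)
(* successor on 'I_m. The guard [i != j] matters only for m = 1, where it     *)
(* excludes a loop.                                                           *)
Definition wheel_adj (m : nat) : rel (option 'I_m) := fun x y =>
  match x, y with
  | Some i, Some j => (i != j) && ((j == ordS i) || (i == ordS j))
  | None, None => false
  | _, _ => true
  end.

Lemma wheel_adj_sym (m : nat) : symmetric (@wheel_adj m).
Proof. by move=> [i|] [j|] //=; rewrite eq_sym orbC. Qed.

Lemma wheel_adj_irr (m : nat) : irreflexive (@wheel_adj m).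
Proof. by move=> [i|] //=; rewrite eqxx. Qed.

Definition wheel (m : nat) : sgraph :=
  SGraph (@wheel_adj_sym m) (@wheel_adj_irr m).

(* Main.v *)
Require Import Defs.
From mathcomp Require Import all_boot.
From mathcomp Require Import zify.

(* A vertex of degree d sees d + 1 distinct colors, so m + 1 colors are       *)
(* needed at the center of W_m. In K_4 two adjacent vertices of degree 3      *)
(* would both see all of 1, ..., 4 and have equal sums, so 5 are needed.      *)
(* Conversely, for m >= 5, give the center color m + 1 and, with colors       *)
(* 1, ..., m read modulo m, give the spoke, the two rim edges and the vertex  *)
(* at the i-th rim vertex the colors i, i + 1, i + 2, i + 3. The cases m = 3  *)
(* and m = 4 have explicit colorings.                                         *)

Set Implicit Arguments.
Unset Strict Implicit.
Unset Printing Implicit Defensive.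

(** Both lower bounds come from the palette at a vertex, [colors_at]: it has degree + 1 distinct
    entries in 1..k ([degree_lt]), and if k equals degree + 1 it is all of 1..k, so the sum there is
    forced ([total_sum_full]). For the upper bounds, [sum_colorable_wheel] reduces a coloring of the
    wheel to conditions on cyclic data. The cyclic pattern works for m >= 5: neighboring palettes
    differ in one color, and the center sum exceeds 4m, which bounds every rim sum
    ([ltn_mul4_sum]). *)

(** * Edges at a vertex and its neighbors *)

Lemma edge_set2 (G : sgraph) (u v : G) : adj u v -> [set u; v] \in edges G.
Proof.
by move=> uv; rewrite inE; apply/existsP; exists u; apply/existsP; exists v;
   rewrite uv eqxx.
Qed.

Lemma edgesP (G : sgraph) (e : {set G}) :
  reflect (exists u v : G, adj u v /\ e = [set u; v]) (e \in edges G).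
Proof.
rewrite inE; apply: (iffP existsP) => [[u /existsP[v /andP[uv /eqP->]]]|].
  by exists u, v.
by move=> [u [v [uv ->]]]; exists u; apply/existsP; exists v; rewrite uv eqxx.
Qed.

Lemma edges_atP (G : sgraph) (e : {set G}) (v : G) :
  reflect (exists2 u : G, adj v u & e = [set v; u])
          ((e \in edges G) && (v \in e)).
Proof.
apply: (iffP andP) => [[/edgesP[x [y [xy ->]]]]|[u vu ->]]; last first.
  by rewrite edge_set2 // set21.
rewrite !inE => /orP[] /eqP->; first by exists y.
by exists x; rewrite 1?adj_sym // setUC.
Qed.

Lemma set2_injr (T : finType) (v : T) : injective (fun u => [set v; u]).
Proof.
move=> u w /setP eq_e; have := eq_e u; have := eq_e w.
rewrite !inE !eqxx !orbT; case: (eqVneq w v) => [->|_] /=.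
  by rewrite orbb => _ /esym/eqP.
by move=> /eqP ->.
Qed.

Lemma edges_at (G : sgraph) (v : G) :
  [set e in edges G | v \in e] = [set [set v; u] | u in [set u | adj v u]].
Proof.
apply/setP=> e; rewrite inE; apply/edges_atP/imsetP => [[u vu ->]|[u]].
  by exists u; rewrite ?inE.
by rewrite inE => vu ->; exists u.
Qed.

(** * Palettes and lower bounds *)

Section TotalColoring.

Variables (G : sgraph) (k : nat) (cv : G -> nat) (ce : {set G} -> nat).

Definition colors_at (v : G) : seq nat :=
  cv v :: [seq ce [set v; u] | u <- enum [set u | adj v u]].

Lemma size_colors_at v : size (colors_at v) = (degree v).+1.
Proof. by rewrite /= size_map -cardE. Qed.

Lemma sumn_colors_at v :
  sumn (colors_at v) = cv v + \sum_(u | adj v u) ce [set v; u].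
Proof.
rewrite /= sumnE big_map big_enum /=; congr (_ + _).
by apply: eq_bigl => u; rewrite inE.
Qed.

Lemma total_sum_neighbors v :
  total_sum cv ce v = cv v + \sum_(u | adj v u) ce [set v; u].
Proof.
congr (_ + _).
rewrite (eq_bigl (mem [set e in edges G | v \in e])); last first.
  by move=> e; rewrite !inE.
rewrite edges_at big_imset /=; last by move=> u w _ _; apply: set2_injr.
by apply: eq_bigl => u; rewrite inE.
Qed.

Hypothesis col : proper_total_coloring k cv ce.

Lemma uniq_colors_at v : uniq (colors_at v).
Proof.
case: col => _ _ eeP evP; rewrite /= map_inj_in_uniq ?enum_uniq ?andbT.
  apply/mapP => -[u]; rewrite mem_enum inE => vu /esym.
  by apply: evP; rewrite ?edge_set2 ?set21.
move=> u w; rewrite !mem_enum !inE => vu vw eq_c; apply/eqP.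
apply: contra_eqT eq_c => neq_uw; apply/eqP.
apply: eeP; rewrite ?edge_set2 //; last by exists v; rewrite !set21.
by move=> /set2_injr /eqP; apply/negP.
Qed.

Lemma colors_at_sub v : {subset colors_at v <= iota 1 k}.
Proof.
case: col => -[vP eP] _ _ _ x; rewrite mem_iota add1n ltnS inE.
case/predU1P=> [->|/mapP[u]]; first exact: vP.
by rewrite mem_enum inE => vu ->; apply/eP/edge_set2.
Qed.

(** Pigeonhole on the palette of [v]. *)
Lemma degree_lt (v : G) : degree v < k.
Proof.
rewrite -size_colors_at -(size_iota 1 k).
exact: uniq_leq_size (uniq_colors_at v) (@colors_at_sub v).
Qed.

(** A duplicate-free palette of size k inside 1..k is a permutation of it. *)
Lemma total_sum_full (v : G) :
  k = (degree v).+1 -> total_sum cv ce v = sumn (iota 1 k).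
Proof.
move=> kE; rewrite total_sum_neighbors -sumn_colors_at; apply: perm_sumn.
apply: uniq_perm (uniq_colors_at v) (iota_uniq 1 k) _.
have [|//] := uniq_min_size (uniq_colors_at v) (@colors_at_sub v).
by rewrite size_iota size_colors_at kE.
Qed.

End TotalColoring.

Lemma degree_lt_sum_colorable (G : sgraph) (k : nat) (v : G) :
  sum_colorable G k -> degree v < k.
Proof. by move=> [cv [ce [col _]]]; apply: degree_lt col v. Qed.

(* With only [degree + 1] colors both endpoints would see every color, hence  *)
(* have equal sums.                                                           *)
Lemma adj_degree_lt_sum_colorable (G : sgraph) (k : nat) (u v : G) :
  adj u v -> degree u = degree v -> sum_colorable G k -> (degree v).+1 < k.
Proof.
move=> uv duv [cv [ce [col dist]]]; rewrite ltn_neqAle (degree_lt col) andbT.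
apply/eqP => /esym kE; apply: (dist u v uv).
by rewrite !(total_sum_full col) ?duv.
Qed.

(** * Edge colorings from symmetric functions of ordered pairs *)

Section EdgeColorOfPairs.

Variables (G : sgraph) (c : G -> G -> nat).
Hypothesis c_sym : forall u v, adj u v -> c u v = c v u.

(** An edge is an unordered set, so an arbitrary orientation is picked; symmetry of [c] makes the
    choice immaterial. The default 0 is never reached on an edge. *)
Definition edge_color (e : {set G}) : nat :=
  if [pick p : G * G | adj p.1 p.2 && (e == [set p.1; p.2])] is Some p
  then c p.1 p.2 else 0.

Lemma edge_colorE u v : adj u v -> edge_color [set u; v] = c u v.
Proof.
move=> uv; rewrite /edge_color; case: pickP => [[x y] /= /andP[xy /eqP eq_e]|].
  have : x \in [set u; v] by rewrite eq_e set21.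
  rewrite !inE => /orP[] /eqP xE; rewrite xE in xy eq_e *.
    by rewrite (set2_injr eq_e).
  by move: eq_e; rewrite (c_sym uv) setUC => /set2_injr ->.
by move/(_ (u, v)); rewrite /= uv eqxx.
Qed.

Lemma sum_colorable_of_pairs (k : nat) (cv : G -> nat) :
  (forall v, 1 <= cv v <= k) ->
  (forall u v, adj u v -> 1 <= c u v <= k) ->
  (forall u v, adj u v -> cv u <> cv v) ->
  (forall v u w, adj v u -> adj v w -> u <> w -> c v u <> c v w) ->
  (forall v u, adj v u -> c v u <> cv v) ->
  (forall u v, adj u v ->
     cv u + \sum_(w | adj u w) c u w <> cv v + \sum_(w | adj v w) c v w) ->
  sum_colorable G k.
Proof.
move=> vP eP vvP eeP evP dist; exists cv, edge_color; split; last first.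
  move=> u v uv; rewrite !total_sum_neighbors.
  rewrite (eq_bigr (c u)) => [|w uw]; last by rewrite edge_colorE.
  rewrite [in X in _ <> X](eq_bigr (c v)) => [|w vw]; last by rewrite edge_colorE.
  exact: dist.
split=> //.
- by split=> // e /edgesP[u [v [uv ->]]]; rewrite edge_colorE ?eP.
- move=> e1 e2 e1G e2G neq_e [v [ve1 ve2]].
  have /edges_atP[u vu e1E] : (e1 \in edges G) && (v \in e1) by rewrite e1G.
  have /edges_atP[w vw e2E] : (e2 \in edges G) && (v \in e2) by rewrite e2G.
  rewrite e1E e2E !edge_colorE //; apply: eeP => // eq_uw.
  by apply: neq_e; rewrite e1E e2E eq_uw.
- move=> e v eG ve.
  have /edges_atP[u vu ->] : (e \in edges G) && (v \in e) by rewrite eG.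
  by rewrite edge_colorE //; apply: evP.
Qed.

End EdgeColorOfPairs.

(** * Neighborhoods and degrees in the wheel *)

Lemma neq_ordS m (i : 'I_m) : 1 < m -> ordS i != i.
Proof.
move=> m_gt1; rewrite -val_eqE /=; have im := ltn_ord i.
have [lt|ge] := ltnP i.+1 m; first by rewrite modn_small //; lia.
by rewrite -(subnK ge) modnDr modn_small; lia.
Qed.

Lemma ordS_neq_ord_pred m (i : 'I_m) : 2 < m -> ordS i != ord_pred i.
Proof.
(* Applying [ordS] to both sides leaves i + 2 against i modulo m. *)
move=> m_gt2; rewrite -(inj_eq (@ordS_inj m)) ord_predK -val_eqE /=.
have im := ltn_ord i; rewrite -addn1 modnDml addn1.
have [lt|ge] := ltnP i.+2 m; first by rewrite modn_small //; lia.
by rewrite -(subnK ge) modnDr modn_small; lia.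
Qed.

Lemma wheel_adj_rim m (i j : 'I_m) : 1 < m ->
  wheel_adj (Some i) (Some j) = (j == ordS i) || (j == ord_pred i).
Proof.
move=> m_gt1 /=; rewrite -[j == ord_pred i](inj_eq (@ordS_inj m)) ord_predK (eq_sym (ordS j)).
have [->|//] := eqVneq i j.
by rewrite eq_sym (negPf (neq_ordS _ _)).
Qed.

Lemma big_wheel_center m (F : option 'I_m -> nat) :
  \sum_(x | wheel_adj None x) F x = \sum_(i < m) F (Some i).
Proof.
rewrite (reindex_omap Some id) => [|[] //].
by apply: eq_bigl => i /=; rewrite eqxx.
Qed.

Lemma big_wheel_rim m (F : option 'I_m -> nat) i : 2 < m ->
  \sum_(x | wheel_adj (Some i) x) F x =
    F None + F (Some (ordS i)) + F (Some (ord_pred i)).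
Proof.
move=> m_gt2; have m_gt1 := ltnW m_gt2.
rewrite -addnA (bigD1 None) //; congr (_ + _).
rewrite (bigD1 (Some (ordS i))) /=; last first.
  by rewrite eqxx eq_sym neq_ordS.
congr (_ + _); rewrite (big_pred1 (Some (ord_pred i))) // => -[j|] //.
rewrite andbT; rewrite [X in X && _](wheel_adj_rim _ _ m_gt1) -[RHS]/(j == _).
rewrite -[Some j == _]/(j == _).
have [->|//] := eqVneq j (ordS i).
  by rewrite andbF (negPf (ordS_neq_ord_pred _ _)).
by rewrite andbT.
Qed.

Lemma degree_wheel_center m : degree (None : wheel m) = m.
Proof.
rewrite /degree -sum1_card (eq_bigl (wheel_adj None)) => [|x]; last by rewrite inE.
by rewrite big_wheel_center sum1_card card_ord.
Qed.

Lemma degree_wheel_rim m (i : 'I_m) : 2 < m -> degree (Some i : wheel m) = 3.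
Proof.
move=> m_gt2; rewrite /degree -sum1_card.
rewrite (eq_bigl (wheel_adj (Some i))) => [|x]; last by rewrite inE.
by rewrite big_wheel_rim.
Qed.

Lemma max_degree_wheel m : 2 < m -> max_degree (wheel m) = m.
Proof.
move=> m_gt2; apply/eqP; rewrite eqn_leq; apply/andP; split.
  apply/bigmax_leqP => -[i|] _; last by rewrite degree_wheel_center.
  by rewrite degree_wheel_rim.
rewrite -[leqLHS](degree_wheel_center m).
exact: (leq_bigmax (F := fun v : wheel m => degree v)).
Qed.

(** * Wheel colorings from cyclic data *)

Section WheelColoring.

(* [r i] is the color of the rim edge from [i] to [ordS i].                   *)
Variables (m k c0 : nat) (s v r : 'I_m -> nat).
Hypothesis m_gt2 : 2 < m.

Definition wheel_vertex_color (x : wheel m) : nat :=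
  if x is Some i then v i else c0.

(** On adjacent rim vertices with [j] not [ordS i], [i] is [ordS j], hence the color [r j]. *)
Definition wheel_pair_color (x y : wheel m) : nat :=
  match x, y with
  | Some i, Some j => if j == ordS i then r i else r j
  | None, Some i | Some i, None => s i
  | None, None => 0
  end.

Lemma wheel_pair_color_succ i :
  wheel_pair_color (Some i) (Some (ordS i)) = r i.
Proof. by rewrite /= eqxx. Qed.

Lemma wheel_pair_color_pred i :
  wheel_pair_color (Some i) (Some (ord_pred i)) = r (ord_pred i).
Proof. by rewrite /= eq_sym (negPf (ordS_neq_ord_pred _ _)). Qed.

(** A symmetric property need only be checked on one orientation of each spoke and rim edge. *)
Lemma wheel_adj_ind (P : wheel m -> wheel m -> Prop) :
  (forall x y : wheel m, adj x y -> P y x -> P x y) ->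
  (forall i, P None (Some i)) ->
  (forall i, P (Some i) (Some (ordS i))) ->
  forall x y : wheel m, adj x y -> P x y.
Proof.
move=> Psym Pc Pr [i|] [j|] // xy; last by apply: Psym.
have m_gt1 := ltnW m_gt2; have := xy; rewrite [adj _ _]wheel_adj_rim //.
move=> /orP[] /eqP jE; first by rewrite jE.
by apply: Psym => //; have := Pr j; rewrite {2}jE ord_predK.
Qed.

Lemma wheel_pair_colorC (x y : wheel m) :
  adj x y -> wheel_pair_color x y = wheel_pair_color y x.
Proof.
move: x y; apply: wheel_adj_ind => [x y _ -> //|//|i].
by rewrite wheel_pair_color_succ -{3}(ordSK i) wheel_pair_color_pred ordSK.
Qed.

(** The [uniq] hypothesis handles all edge-edge and vertex-edge conflicts at a rim vertex;
    injectivity of [s] handles the edges at the center. *)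
Lemma sum_colorable_wheel :
  1 <= c0 <= k ->
  (forall i, [/\ 1 <= s i <= k, 1 <= v i <= k & 1 <= r i <= k]) ->
  injective s ->
  (forall i, c0 != s i) ->
  (forall i, c0 != v i) ->
  (forall i, v i != v (ordS i)) ->
  (forall i, uniq [:: v i; s i; r i; r (ord_pred i)]) ->
  (forall i, v i + s i + r i + r (ord_pred i) <>
             v (ordS i) + s (ordS i) + r (ordS i) + r i) ->
  (forall i, v i + s i + r i + r (ord_pred i) <> c0 + \sum_j s j) ->
  sum_colorable (wheel m) k.
Proof.
move=> c0P bP s_inj c0s c0v vv locP rimP cenP.
have sum_rim i : wheel_vertex_color (Some i) +
    \sum_(w | @adj (wheel m) (Some i) w) wheel_pair_color (Some i) w =
    v i + s i + r i + r (ord_pred i).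
  rewrite big_wheel_rim // wheel_pair_color_succ wheel_pair_color_pred.
  by rewrite !addnA.
have sum_cen : wheel_vertex_color None +
    \sum_(w | @adj (wheel m) None w) wheel_pair_color None w = c0 + \sum_j s j.
  by rewrite big_wheel_center.
have rim_nbr (i : 'I_m) (x : wheel m) : adj (Some i : wheel m) x ->
    [\/ x = None, x = Some (ordS i) | x = Some (ord_pred i)].
  case: x => [j|_]; last by constructor.
  rewrite [adj _ _]wheel_adj_rim ?(ltnW m_gt2) //.
  by move=> /orP[] /eqP->; [constructor 2|constructor 3].
have pred_neqS (i : 'I_m) : (ord_pred i == ordS i) = false.
  by rewrite eq_sym (negPf (ordS_neq_ord_pred _ _)).
apply: (@sum_colorable_of_pairs _ wheel_pair_color _ _ wheel_vertex_color).
- exact: wheel_pair_colorC.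
- by move=> [i|] //=; case: (bP i).
- apply: wheel_adj_ind => [x y xy|i|i]; first by rewrite (wheel_pair_colorC xy).
    by case: (bP i).
  by rewrite wheel_pair_color_succ; case: (bP i).
- apply: wheel_adj_ind => [x y _ /nesym //|i|i]; apply/eqP; [exact: c0v|exact: vv].
- move=> [i|] x y; last first.
    by case: x y => [i|] [j|] //= _ _ neq /s_inj ij; apply: neq; rewrite ij.
  have := locP i; rewrite /= !inE !negb_or -!andbA !andbT.
  move=> /and5P[_ _ _ /eqP sr /andP[/eqP srp /eqP rrp]].
  by move=> /rim_nbr[] -> /rim_nbr[] -> // _; rewrite /= ?eqxx ?pred_neqS //;
    apply: nesym.
- move=> [i|] x; last first.
    by case: x => // i _; apply/nesym/eqP/c0s.
  have := locP i; rewrite /= !inE !negb_or -!andbA !andbT.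
  move=> /and5P[/eqP vs /eqP vr /eqP vrp _ _].
  by move=> /rim_nbr[] ->; rewrite /= ?eqxx ?pred_neqS; apply: nesym.
- apply: wheel_adj_ind => [x y _ /nesym //|i|i].
    by rewrite sum_cen sum_rim; apply/nesym/cenP.
  by rewrite !sum_rim ordSK.
Qed.

End WheelColoring.

(** * The colorings *)

(** Rim sums 12, 11, 13; center sum 10. *)
Lemma sum_colorable_wheel3 : sum_colorable (wheel 3) 5.
Proof.
apply: (@sum_colorable_wheel 3 5 4 (fun i => nth 0 [:: 1; 2; 3] i)
          (fun i => nth 0 [:: 2; 3; 5] i) (fun i => nth 0 [:: 5; 1; 4] i)) => //;
  try by case=> [[|[|[]]]].
  by move=> [[|[|[]]] // ?] [[|[|[]]] // ?] //= _; apply: val_inj.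
by case=> [[|[|[]]]] // ?; rewrite !big_ord_recl big_ord0.
Qed.

(** The cyclic pattern fails here, since i + 4 and i agree modulo 4. Rim sums 11, 12, 14, 13; center
    sum 15. *)
Lemma sum_colorable_wheel4 : sum_colorable (wheel 4) 5.
Proof.
apply: (@sum_colorable_wheel 4 5 5 (fun i => nth 0 [:: 1; 2; 3; 4] i)
          (fun i => nth 0 [:: 2; 1; 2; 1] i)
          (fun i => nth 0 [:: 5; 4; 5; 3] i)) => //;
  try by case=> [[|[|[|[]]]]].
  by move=> [[|[|[|[]]]] // ?] [[|[|[|[]]]] // ?] //= _; apply: val_inj.
by case=> [[|[|[|[]]]]] // ?; rewrite !big_ord_recl big_ord0.
Qed.

(** Turns the residues of the cyclic pattern into case splits that [lia] can decide. *)
Lemma modn_lt2 m x : x < m.*2 -> x %% m = if x < m then x else x - m.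
Proof.
have [/modn_small //|ge] := ltnP x m; rewrite -{2}(subnK ge) modnDr => lt.
by rewrite modn_small //; lia.
Qed.

(** Tight at the base: 20 < 21 for m = 5, while m = 4 gives 16 against 15. *)
Lemma ltn_mul4_sum m : 4 < m -> 4 * m < m.+1 + \sum_(i < m) i.+1.
Proof.
elim: m => // m IHm; rewrite ltnS leq_eqVlt => /predU1P[<-|lt4m].
  by rewrite !big_ord_recl big_ord0.
rewrite big_ord_recr /=; move: (IHm lt4m).
by move: (\sum_(i < m) i.+1) => S; lia.
Qed.

(* Passing from a rim vertex to its successor replaces, among the four colors *)
(* summed, [i] by [i + 4], which is a different residue since [m > 4].        *)
Lemma sum_colorable_wheel_ge5 m : 4 < m -> sum_colorable (wheel m) m.+1.
Proof.
move=> m_gt4; have m_gt2 : 2 < m by lia.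
pose s (i : 'I_m) := i.+1.
pose v (i : 'I_m) := ((i + 3) %% m).+1.
pose r (i : 'I_m) := ((i + 2) %% m).+1.
have rpE i : r (ord_pred i) = ((i + 1) %% m).+1.
  (* The predecessor is i + m - 1 modulo m, so adding 2 gives i + 1 + m. *)
  by rewrite /r /= modnDml; congr (_.+1); rewrite -(modnDr (i + 1)); congr modn; lia.
have rSE i : r (ordS i) = ((i + 3) %% m).+1.
  by rewrite /r /= modnDml; congr (_ %% m).+1; lia.
have vSE i : v (ordS i) = ((i + 4) %% m).+1.
  by rewrite /v /= modnDml; congr (_ %% m).+1; lia.
have sSE i : s (ordS i) = ((i + 1) %% m).+1 by rewrite /s /= addn1.
have bnd x : x %% m < m by rewrite ltn_mod; lia.
have cases (i : 'I_m) d : d < m ->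
    (i + d) %% m = if i + d < m then i + d else i + d - m.
  by move=> dm; apply: modn_lt2; have := ltn_ord i; lia.
apply: (@sum_colorable_wheel m m.+1 m.+1 s v r) => //.
- by rewrite leqnn.
- by move=> i; rewrite /s /v /r; have := ltn_ord i;
    have := bnd (i + 3); have := bnd (i + 2); split; lia.
- by move=> i j /succn_inj/val_inj.
- by move=> i; rewrite /s; have := ltn_ord i; lia.
- by move=> i; rewrite /v; have := bnd (i + 3); lia.
- move=> i; rewrite vSE /v !cases; [|lia..].
  by have := ltn_ord i; do 2![case: ifP]; lia.
- move=> i; rewrite rpE /= !inE /v /s /r !cases; [|lia..].
  by have := ltn_ord i; do 3![case: ifP]; lia.
- move=> i; rewrite rpE rSE vSE sSE /v /s /r !cases; [|lia..].
  by have := ltn_ord i; do 4![case: ifP]; lia.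
(* Each of the four colors at a rim vertex is at most m, so its sum is at most 4m. *)
- move=> i; have := ltn_mul4_sum m_gt4; rewrite rpE -/(\sum_i s i) /v /r.
  move: (\sum_i s i) => S; rewrite /s.
  have := bnd (i + 3); have := bnd (i + 2); have := bnd (i + 1).
  have := ltn_ord i; lia.
Qed.

Theorem theorem3p2 (m : nat) (hm : 3 <= m) :
  (4 <= m -> is_avd_sum_index (wheel m) (max_degree (wheel m) + 1)) /\
  (m = 3 -> is_avd_sum_index (wheel m) (max_degree (wheel m) + 2)).
Proof.
rewrite max_degree_wheel //; split=> [|m3]; last first.
  subst m; split=> [|k]; first exact: sum_colorable_wheel3.
  (* For m = 3 the center also has degree 3, so any spoke joins vertices of equal degree. *)
  move/(@adj_degree_lt_sum_colorable (wheel 3) k (Some ord0) None isT).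
  by rewrite degree_wheel_rim // degree_wheel_center; apply.
rewrite leq_eqVlt addn1 => m4; split=> [|k /degree_lt_sum_colorable].
  case/predU1P: m4 => [<-|]; first exact: sum_colorable_wheel4.
  exact: sum_colorable_wheel_ge5.
by move/(_ None); rewrite degree_wheel_center.
Qed.
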